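(* For each integer $k\ge 1$ there is a countable ($T_1$) topological space $X_k$ with exactly one non-isolated point $p$ such that player One has a winning strategy in the game $\mathsf{G}_k(\Omega_p,\Omega_p)$ on $X_k$ and player Two has a winning strategy in the game $\mathsf{G}_{k+1}(\Omega_p,\Omega_p)$ on $X_k$.
   Context: All topological spaces are assumed to be $T_1$. For a space $X$ and $x\in X$, let $\Omega_x=\{A\subseteq X: x\in\overline{A}\}$. For an integer $m\ge1$, the game $\mathsf{G}_m(\Omega_x,\Omega_x)$ on $X$ is played by One and Two: in each inning $n\in\omega$, One chooses $A_n\in\Omega_x$, and then Two selects $F_n\subseteq A_n$ with $|F_n|\le m$. Two wins if $\bigcup_{n\in\omega}F_n\in\Omega_x$; otherwise One wins. *)

(* Defs.v *)
From HB Require Import structures.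
From mathcomp Require Import all_boot all_order.
From mathcomp Require Import boolp classical_sets functions cardinality topology.

Set Implicit Arguments.
Unset Strict Implicit.
Unset Printing Implicit Defensive.

Local Open Scope classical_set_scope.
Local Open Scope card_scope.

Section SelectionGame.
Context {X : topologicalType}.

Definition Omega (x : X) : set (set X) := [set A | closure A x].

Definition two_move (m : nat) (A F : set X) : Prop :=
  F `<=` A /\ F #<= `I_m.

Definition two_wins_play (x : X) (F : nat -> set X) : Prop :=
  Omega x (\bigcup_n F n).

(* A strategy depends only on the opponent's earlier moves: in inning n, One
   sees [:: F 0; ...; F n.-1].  The play determined by the strategy and any
   legal moves of Two must consist of legal moves of One and be lost by Two.
   Since the empty set is a legal move for Two, every finite legal history
   extends to such a play, so legality is required at all of them. *)
Definition one_winning_strategy (m : nat) (x : X)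
    (sigma : seq (set X) -> set X) : Prop :=
  forall F : nat -> set X,
    (forall n, two_move m (sigma (mkseq F n)) (F n)) ->
    (forall n, Omega x (sigma (mkseq F n))) /\ ~ two_wins_play x F.

(* In inning n, Two also sees One's current move: [:: A 0; ...; A n]. *)
Definition two_winning_strategy (m : nat) (x : X)
    (tau : seq (set X) -> set X) : Prop :=
  forall A : nat -> set X,
    (forall n, Omega x (A n)) ->
    (forall n, two_move m (A n) (tau (mkseq A n.+1))) /\
    two_wins_play x (fun n => tau (mkseq A n.+1)).

Definition one_has_winning_strategy (m : nat) (x : X) : Prop :=
  exists sigma, one_winning_strategy m x sigma.

Definition two_has_winning_strategy (m : nat) (x : X) : Prop :=
  exists tau, two_winning_strategy m x tau.

End SelectionGame.

(* Main.v *)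
Require Import Defs.
From HB Require Import structures.
From mathcomp Require Import all_boot all_order.
From mathcomp Require Import finmap boolp classical_sets functions cardinality topology.
From mathcomp Require Import zify.

Set Implicit Arguments.
Unset Strict Implicit.
Unset Printing Implicit Defensive.

Local Open Scope classical_set_scope.
Local Open Scope card_scope.

(* The isolated points are the moves available to One at the various histories
   of a game in which Two selects at most [k] points per inning.  They are
   ordered by "was selected on the way to", and a set accumulates at [p] iff it
   contains arbitrarily large finite antichains.  The points of one play of
   [k]-selections have no antichain of more than [k] points, so One wins by
   offering the points of the current history.  With [k.+1] selections, Two
   raises the maximal antichain size of his picks in every inning: the points
   below a given point contain no antichain of more than [k] points, so [k.+1]
   suitable new points displace at most [k] old ones. *)

Lemma card_le_set_seq (T : choiceType) (s : seq T) : [set` s] #<= `I_(size s).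
Proof.
have -> : [set` s] = [set` [fset x in s]%fset].
  by apply/seteqP; split=> x /=; rewrite inE.
rewrite (card_le_eql (introT card_eq_fsetP (erefl #|` [fset x in s]%fset|))).
by rewrite card_le_II card_fseq size_undup.
Qed.

(** * Finite antichains of a relation, and sets containing arbitrarily large ones *)

Section Width.
Context {T : eqType} (lt : rel T).

Definition antichain (a : seq T) : bool :=
  uniq a && allrel (fun x y => ~~ lt x y) a a.

Lemma antichainP (a : seq T) :
  reflect (uniq a /\ {in a &, forall x y, ~~ lt x y}) (antichain a).
Proof.
apply: (iffP andP) => -[ua /allrelP ha]; split => // x y; exact: ha.
Qed.

Lemma antichain_sub (a b : seq T) :
  uniq b -> {subset b <= a} -> antichain a -> antichain b.
Proof.
move=> ub sba /antichainP[_ ha]; apply/antichainP; split=> // x y xb yb.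
by apply: ha; apply: sba.
Qed.

Lemma antichain_filter (p : pred T) (a : seq T) :
  antichain a -> antichain (seq.filter p a).
Proof.
move=> aa; apply: antichain_sub (aa); last exact/mem_subseq/filter_subseq.
by rewrite filter_uniq//; case/andP: aa.
Qed.

Definition has_antichain (n : nat) (A : set T) : Prop :=
  exists a, [/\ antichain a, n <= size a & forall x, x \in a -> A x].

Definition wide (A : set T) : Prop := forall n, has_antichain n A.

Lemma has_antichain_sub (n : nat) (A B : set T) :
  A `<=` B -> has_antichain n A -> has_antichain n B.
Proof. by move=> AB [a [aa na aA]]; exists a; split=> // x /aA /AB. Qed.

Lemma wide_sub (A B : set T) : A `<=` B -> wide A -> wide B.
Proof. by move=> AB wA n; apply: has_antichain_sub AB _. Qed.

Lemma not_wide_seq (s : seq T) : ~ wide [set` s].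
Proof.
move=> /(_ (size s).+1)[a [/andP[ua _] na aA]].
by have := uniq_leq_size ua aA; rewrite leqNgt na.
Qed.

(** An antichain of [m + n] points in the union has [m] points in [A] or [n] points outside [A].
    Hence the non-wide sets form an ideal. *)
Lemma wideU (A B : set T) : wide (A `|` B) -> wide A \/ wide B.
Proof.
move=> wAB; apply: contrapT => /not_orP[/existsNP[m hm] /existsNP[n hn]].
have [a [aa na aAB]] := wAB (m + n).
pose p x := `[< A x >]; have := count_predC p a.
have [mp|mp] := leqP m (count p a).
  case: hm; exists (seq.filter p a); split; first exact: antichain_filter.
    by rewrite size_filter.
  by move=> x; rewrite mem_filter => /andP[/asboolP].
have [np|np] := leqP n (count (predC p) a); last by lia.
case: hn; exists (seq.filter (predC p) a); split; first exact: antichain_filter.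
  by rewrite size_filter.
by move=> x; rewrite mem_filter => /andP[/asboolP nA /aAB[/nA|]].
Qed.

(** Pigeonhole over the [2 ^ size G] possible traces on [G]: each [g] splits the current class in
    two, and one half is large enough to keep. *)
Lemma common_trace (n : nat) (G a : seq T) : n * 2 ^ size G <= size a ->
  exists p : pred T, n <= count p a /\
    forall g x y, g \in G -> p x -> p y -> lt g x = lt g y.
Proof.
elim: G n => [|g G IH] n /=.
  by rewrite expn0 muln1 => na; exists predT; rewrite count_predT.
rewrite expnS mulnA => /IH[p [np hp]].
have := count_predUI (predI p (lt g)) (predI p (predC (lt g))) a.
rewrite (@eq_count _ _ p); last by move=> x /=; case: (p x); case: (lt g x).
rewrite (@eq_count _ (predI _ _) pred0); last first.
  by move=> x /=; case: (p x); case: (lt g x).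
rewrite count_pred0 addn0 => pE.
have [nq|nq] := leqP n (count (predI p (lt g)) a).
  exists (predI p (lt g)); split=> // h x y.
  rewrite in_cons => /orP[/eqP ->|hG] /andP[px gx] /andP[py gy].
    by rewrite gx gy.
  exact: hp.
exists (predI p (predC (lt g))); split; first by lia.
move=> h x y; rewrite in_cons => /orP[/eqP ->|hG] /andP[px gx] /andP[py gy].
  by rewrite (negbTE gx) (negbTE gy).
exact: hp.
Qed.

Lemma finitely_many_below (G : seq T) :
  (forall y, exists s : seq T, forall x, lt x y -> x \in s) ->
  exists s : seq T, forall x y, y \in G -> lt x y -> x \in s.
Proof.
move=> fin; elim: G => [|g G [s hs]]; first by exists [::].
have [t ht] := fin g; exists (t ++ s) => x y; rewrite in_cons mem_cat.
by move=> /orP[/eqP ->|yG] xy; [rewrite ht|rewrite (hs _ y) ?orbT].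
Qed.

(* The [k.+1] new points form an antichain, lie below no point of [G], and lie
   above the same points of [G].  Replacing by them the points of a maximal
   antichain of [G] that lie below them removes at most [k] points. *)
Lemma raise_width (k : nat) (G : seq T) (A : set T) :
  (forall y, exists s : seq T, forall x, lt x y -> x \in s) ->
  (forall y a, antichain a -> (forall x, x \in a -> lt x y) -> size a <= k) ->
  wide A ->
  exists l : seq T, [/\ size l <= k.+1, forall x, x \in l -> A x &
    forall n, has_antichain n [set` G] -> has_antichain n.+1 [set` G ++ l]].
Proof.
move=> fin wk wA.
have [s hs] := finitely_many_below G fin.
pose old := G ++ s.
(* Discarding [old] costs at most [size old] points; the factor [2 ^ size G] pays for a common trace
   of [k.+1] of the others. As [old] includes [s], no new point lies below [G]. *)
have [a [aa na aA]] := wA (k.+1 * 2 ^ size G + size old).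
pose b := seq.filter [predC old] a.
have nb : k.+1 * 2 ^ size G <= size b.
  rewrite size_filter.
  have := count_predC (mem old) a.
  have : count (mem old) a <= size old.
    rewrite -size_filter; apply: uniq_leq_size.
      by rewrite filter_uniq//; case/andP: aa.
    by move=> x; rewrite mem_filter => /andP[].
  rewrite (@eq_count _ (predC (mem old)) [predC old])//; lia.
have [p [np hp]] := common_trace nb.
pose l := take k.+1 (seq.filter p b).
have sl : size l = k.+1 by rewrite size_takel// size_filter.
have lE x : x \in l -> [/\ x \in a, x \notin old & p x].
  by move=> /mem_take; rewrite !mem_filter => /and3P[].
have al : antichain l.
  have := antichain_filter p (antichain_filter [predC old] aa) => af.
  apply: (antichain_sub _ _ af); last by move=> x /mem_take.
  by apply: take_uniq; case/andP: af.
exists l; split; first by rewrite sl.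
  by move=> x /lE[/aA].
move=> n [c [ac nc cG]].
(* All points of [l] have the same trace on [G], so a single [z] decides which old points are
   displaced. *)
have [z zl] : exists z, z \in l.
  by case: (l) sl => // z l' _; exists z; rewrite mem_head.
have [za zo pz] := lE _ zl.
pose d := seq.filter (fun g => ~~ lt g z) c.
have nd : n <= size d + k.
  rewrite size_filter; have := count_predC (lt^~ z) c.
  have : count (lt^~ z) c <= k.
    rewrite -size_filter; apply: (wk z); first exact: antichain_filter.
    by move=> x; rewrite mem_filter => /andP[].
  rewrite (@eq_count _ (predC _) (fun g => ~~ lt g z))//; lia.
exists (d ++ l); split; last 2 first.
- by rewrite size_cat sl; lia.
- move=> x; rewrite /= !mem_cat => /orP[|->]; last by rewrite orbT.
  by rewrite mem_filter => /andP[_ /cG ->].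
have dE x : x \in d -> [/\ x \in c, x \in G & ~~ lt x z].
  by rewrite mem_filter => /andP[xz xc]; rewrite xc; split=> //; exact: cG.
have [ud hd] := antichainP _ (antichain_filter (fun g => ~~ lt g z) ac).
have [ul hl] := antichainP _ al.
have lo x : x \in l -> x \notin G /\ x \notin s.
  by move=> /lE[_ + _]; rewrite mem_cat negb_or => /andP[].
apply/antichainP; split.
  rewrite cat_uniq ud ul andbT; apply/hasPn => x /lo[xG _].
  by apply: contra xG => /dE[].
move=> x y; rewrite !mem_cat => /orP[xd|xl] /orP[yd|yl].
- exact: hd.
- have [_ xG xz] := dE _ xd; have [_ _ py] := lE _ yl.
  by rewrite (hp x y z).
- have [_ yG _] := dE _ yd; have [_ xs] := lo _ xl.
  by apply: contra xs; apply: hs.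
- exact: hl.
Qed.

End Width.

(* [(s, n)] is the [n]-th point offered to Two after the history [s], the list
   of Two's earlier selections; it lies below [(t, m)] when the history [t]
   extends [s] and [n] was selected at [s].  The truncation [take k] makes
   every history one of selections of at most [k] points. *)
Definition point : Type := (seq (seq nat) * nat)%type.

HB.instance Definition _ := Countable.on point.

(* The unused parameter lets the topology, declared below, depend on [k]. *)
Definition space (k : nat) : Type := option point.

HB.instance Definition _ (k : nat) := Countable.on (space k).

(** * The order on offered points and the topology it induces *)

Section Space.
Variable k : nat.

Definition below (x y : point) : bool :=
  [&& size x.1 < size y.1, x.1 == take (size x.1) y.1 &
      x.2 \in take k (nth [::] y.1 (size x.1))].

Lemma below_finite (y : point) :
  exists s : seq point, forall x, below x y -> x \in s.
Proof.
exists [seq (take i y.1, n) | i <- iota 0 (size y.1), n <- nth [::] y.1 i].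
move=> [s n] /and3P[/= ss /eqP es /mem_take ns].
apply/allpairsPdep; exists (size s), n; split=> //.
  by rewrite mem_iota.
by rewrite -es.
Qed.

(* Points below [y] at different levels are comparable. *)
Lemma below_narrow (y : point) (a : seq point) :
  antichain below a -> (forall x, x \in a -> below x y) -> size a <= k.
Proof.
move=> /antichainP[ua ha] ay.
have [-> //|[x0 x0a]] : a = [::] \/ exists x0, x0 \in a.
  by case: (a) => [|x0 a']; [left|right; exists x0; rewrite mem_head].
have lev x z : x \in a -> z \in a -> size x.1 <= size z.1.
  move=> xa za; rewrite leqNgt; apply/negP => zx.
  have /and3P[zy /eqP ez nz] := ay _ za.
  have /and3P[xy /eqP ex nx] := ay _ xa.
  apply/negP: (ha _ _ za xa); rewrite negbK; apply/and3P; split=> //.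
    by rewrite ex take_takel 1?ltnW// -ez.
  by rewrite ex nth_take.
(* All points of [a] now share the history [x0.1], so they are determined by their numbers, which
   lie in one truncated entry of [y.1]. *)
apply: (@leq_trans (size (take k (nth [::] y.1 (size x0.1))))); last first.
  by rewrite size_take_min geq_minl.
rewrite -(size_map (fun n => (x0.1, n) : point)).
apply: uniq_leq_size => // x xa.
have ex : size x.1 = size x0.1 by apply/eqP; rewrite eqn_leq !lev.
have /and3P[_ /eqP e nx] := ay _ xa.
have /and3P[_ /eqP e0 _] := ay _ x0a.
apply/mapP; exists x.2; first by rewrite -ex.
by rewrite e0 -ex -e; case: (x).
Qed.

(** Points with a common history are incomparable, since [below] requires a strictly longer one. *)
Lemma wide_innings (s : seq (seq nat)) (A : set point) :
  (forall n, A (s, n)) -> wide below A.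
Proof.
move=> sA n; exists [seq (s, i) | i <- iota 0 n]; split.
- apply/antichainP; split; first by rewrite map_inj_uniq ?iota_uniq// => i j [].
  by move=> x y /mapP[i _ ->] /mapP[j _ ->]; rewrite /below ltnn.
- by rewrite size_map size_iota.
- by move=> x /mapP[i _ ->].
Qed.


Definition trace (A : set (space k)) : set point := [set x | A (Some x)].

(** The neighbourhood filter of [None] is dual to the ideal of non-wide sets; every other point is
    isolated. *)
Definition space_open (U : set (space k)) : Prop :=
  U None -> ~ wide below (trace (~` U)).

Lemma space_openT : space_open setT.
Proof.
move=> _ /(wide_sub (B := [set` [::]])) h; apply: not_wide_seq (h _) => x.
by move=> /(_ I).
Qed.

Lemma space_openI : setI_closed space_open.
Proof.
move=> U V oU oV [/oU nU /oV nV] w.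
suff /wideU[/nU|/nV] : wide below (trace (~` U) `|` trace (~` V)) by [].
by apply: wide_sub w => x; rewrite /trace /= not_andP.
Qed.

Lemma space_open_bigU (I : Type) (f : I -> set (space k)) :
  (forall i, space_open (f i)) -> space_open (\bigcup_i f i).
Proof.
move=> of_ [i _ /of_ nw] w; apply: nw; apply: wide_sub w => x nx fx.
by apply: nx; exists i.
Qed.

HB.instance Definition _ :=
  isOpenTopological.Build (space k) space_openT space_openI space_open_bigU.

Lemma space_openE (U : set (space k)) : open U = space_open U.
Proof. by []. Qed.

Lemma Omega_None (A : set (space k)) :
  Omega (None : space k) A <-> A None \/ wide below (trace A).
Proof.
split=> [clA|[An|wA]]; last 2 first.
- exact: subset_closure.
- move=> B; rewrite nbhsE => -[U [oU Un] UB].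
  apply: contrapT => /nonemptyPn AB0; apply: oU => //.
  apply: wide_sub wA => x Ax Ux; suff : (A `&` B) (Some x) by rewrite AB0.
  by split=> //; exact: UB.
apply: contrapT => /not_orP[nA nw].
have [] := clA (~` A); last by move=> x [].
apply: open_nbhs_nbhs; split=> //; rewrite space_openE => _ w.
by apply: nw; apply: wide_sub w => x /contrapT.
Qed.

Lemma space_accessible : accessible_space (space k).
Proof.
move=> x y xy; exists (~` [set y]); rewrite space_openE; split; last 2 first.
- by rewrite inE /=; apply/eqP.
- by rewrite inE /=; apply.
case: y xy => [y|] _; last by move=> /(_ erefl).
move=> _ w; apply: (@not_wide_seq _ below [:: y]); apply: wide_sub w => z.
by move=> /contrapT[->]; rewrite /= mem_head.
Qed.

Lemma space_isolated : ~` isolated [set: space k] = [set None].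
Proof.
apply/seteqP; split=> [[x|//] nx|_ -> [_ [V Vn VN]]].
  case: nx; split; first by rewrite inE.
  exists [set Some x]; last by rewrite setIT.
  by apply: open_nbhs_nbhs; split=> //; rewrite space_openE.
move: Vn; rewrite nbhsE => -[U [oU Un] UV].
(* The points with empty history form a wide set, so no neighbourhood of [None] misses them all. *)
apply: oU => //; apply: (wide_innings (s := [::])) => n Ux.
have : (V `&` setT) (Some ([::], n)) by split=> //; exact: UV.
by rewrite VN.
Qed.

End Space.

(** * Winning strategies for One and for Two *)

Section Game.
Variable k : nat.

(** Encodes a move of Two as a list of numbers, so that histories stay countable. The list need only
    cover the numbers picked at [s]; the default never arises for legal moves. *)
Definition selection (s : seq (seq nat)) (F : set (space k)) : seq nat :=
  xget [::] [set l | size l <= k /\ forall n, F (Some (s, n)) -> n \in l].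

Lemma selectionP (s : seq (seq nat)) (F : set (space k)) : F #<= `I_k ->
  size (selection s F) <= k /\ forall n, F (Some (s, n)) -> n \in selection s F.
Proof.
move=> Fk; rewrite /selection; case: xgetP => [l _ //|].
have finF : finite_set F by apply/finite_set_leP; exists k.
pose f (x : space k) := if x is Some y then Some y.2 else None.
(* Numbers picked at other histories are collected too, which is harmless: the length is still
   bounded by the size of [F]. *)
move=> /(_ (pmap f (fset_set F)))[]; split.
  apply: leq_trans (geq_card_fset_set Fk).
  by rewrite size_pmap count_size.
move=> n Fn; rewrite mem_pmap; apply/mapP; exists (Some (s, n)) => //.
by rewrite in_fset_set// inE.
Qed.

Definition history (h : seq (set (space k))) : seq (seq nat) :=
  foldl (fun s F => rcons s (selection s F)) [::] h.

Definition one_strategy (h : seq (set (space k))) : set (space k) :=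
  [set Some (history h, n) | n in setT].

Lemma history_mkseqS (F : nat -> set (space k)) (n : nat) :
  history (mkseq F n.+1) =
  rcons (history (mkseq F n)) (selection (history (mkseq F n)) (F n)).
Proof. by rewrite mkseqS /history foldl_rcons. Qed.

Lemma size_history (F : nat -> set (space k)) (n : nat) :
  size (history (mkseq F n)) = n.
Proof. by elim: n => // n IH; rewrite history_mkseqS size_rcons IH. Qed.

Lemma history_take (F : nat -> set (space k)) (m n : nat) : m < n ->
  take m.+1 (history (mkseq F n)) = history (mkseq F m.+1).
Proof.
elim: n => // n IH; rewrite ltnS leq_eqVlt => /orP[/eqP ->|mn].
  by rewrite -{1}(size_history F n.+1) take_size.
by rewrite history_mkseqS -cats1 takel_cat ?size_history// IH.
Qed.

(** Every later history records the selection of inning [i] at index [i], so a point picked then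
    lies below all points offered later. *)
Lemma below_history (F : nat -> set (space k)) (i j n m : nat) : i < j ->
  F i #<= `I_k -> F i (Some (history (mkseq F i), n)) ->
  below k (history (mkseq F i), n) (history (mkseq F j), m).
Proof.
move=> ij Fk Fin; have hj := history_take F ij.
have [sz ns] := selectionP (history (mkseq F i)) Fk.
apply/and3P; rewrite /= !size_history; split=> //.
  rewrite -(@take_takel _ i i.+1)// hj history_mkseqS -cats1.
  by rewrite takel_cat ?size_history// -{2}(size_history F i) take_size.
rewrite -(@nth_take i.+1)// hj history_mkseqS nth_rcons size_history ltnn eqxx.
(* The truncation in [below] is void here, a legal selection having at most [k] entries. *)
by rewrite take_oversize//; exact: ns.
Qed.

Lemma one_wins : one_has_winning_strategy k (None : space k).
Proof.
exists one_strategy => F legal; split=> [n|].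
  apply/Omega_None; right; apply: (@wide_innings k (history (mkseq F n))) => m.
  by exists m.
(* One never offers [None], so it remains to refute an antichain of [k.+1] picks. *)
move=> /Omega_None[[n _ /(legal n).1[m _] //]|/(_ k.+1)].
move=> [a [/antichainP[ua ha] ka aF]].
have inn x : x \in a -> exists i, F i (Some (history (mkseq F i), x.2)) /\
    x = (history (mkseq F i), x.2).
  move=> /aF[i _ Fx]; have [m _ [ex]] := (legal i).1 _ Fx.
  by exists i; move: Fx; rewrite -ex.
have [x0 x0a] : exists x0, x0 \in a.
  by case: (a) ka => // x0 a' _; exists x0; rewrite mem_head.
have [i [Fi ei]] := inn x0 x0a.
(* Picks of different innings are comparable, so the whole antichain was picked in inning [i]. *)
have lev x : x \in a -> x = (history (mkseq F i), x.2) /\ F i (Some x).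
  move=> xa; have [j [Fj ej]] := inn x xa.
  have [ij|ji|ij] := ltngtP i j.
  - have := ha _ _ x0a xa; rewrite ej ei.
    by rewrite below_history//; exact: (legal i).2.
  - have := ha _ _ xa x0a; rewrite ej ei.
    by rewrite below_history//; exact: (legal j).2.
  - by rewrite ij; split=> //; rewrite ej.
have [sz ns] := selectionP (history (mkseq F i)) (legal i).2.
suff : size a <= k by rewrite leqNgt ka.
apply: leq_trans sz.
rewrite -(size_map (fun n => (history (mkseq F i), n) : point)).
apply: uniq_leq_size => // x /lev[ex Fx].
by apply/mapP; exists x.2 => //; apply: ns; rewrite -ex.
Qed.

(** A choice of the list provided by [raise_width], which exists whenever the trace of [A] is
    wide. *)
Definition raising (G : seq point) (A : set (space k)) : seq point :=
  xget [::] [set l | [/\ size l <= k.+1, forall x, x \in l -> trace A x &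
    forall n, has_antichain (below k) n [set` G] ->
              has_antichain (below k) n.+1 [set` G ++ l]]].

Definition extend (G : seq point) (A : set (space k)) : seq point :=
  G ++ raising G A.

(* [None] lies in its own closure, so One may offer it; Two then takes it and
   has won. *)
Definition two_strategy (h : seq (set (space k))) : set (space k) :=
  let A := last setT h in
  if `[< A None >] then [set None]
  else Some @` [set` raising (foldl extend [::] (rev (behead (rev h)))) A].

Lemma two_wins : two_has_winning_strategy k.+1 (None : space k).
Proof.
exists two_strategy => A OA.
pose G n := foldl extend [::] (mkseq A n).
have GS n : G n.+1 = G n ++ raising (G n) (A n).
  by rewrite /G mkseqS foldl_rcons.
have tauE n : two_strategy (mkseq A n.+1) =
    if `[< A n None >] then [set None] else Some @` [set` raising (G n) (A n)].
  (* Beheading the reversed list removes the current move, leaving the earlier ones that build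
     [G n]. *)
  by rewrite /two_strategy mkseqS last_rcons rev_rcons /= revK.
have raisingP n : ~ A n None ->
    [/\ size (raising (G n) (A n)) <= k.+1,
        forall x, x \in raising (G n) (A n) -> trace (A n) x &
        forall m, has_antichain (below k) m [set` G n] ->
              has_antichain (below k) m.+1 [set` G n.+1]].
  move=> nA; rewrite GS /raising; case: xgetP => [l _ //|no].
  have wA : wide (below k) (trace (A n)) by have [|] := (Omega_None _).1 (OA n).
  have [l hl] := raise_width (G n) (@below_finite k) (@below_narrow k) wA.
  by case: (no l).
split=> [n|].
  rewrite tauE; case: asboolP => [An|nA].
    split; first by move=> _ ->.
    by rewrite (card_le_eql card_set1) card_le_II.
  have [sz lA _] := raisingP n nA; split; first by move=> _ [x /lA xA <-].
  apply: card_le_trans (card_image_le _ _) _.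
  by apply: card_le_trans (card_le_set_seq _) _; rewrite card_le_II.
apply/Omega_None.
have [[n An]|/forallNP nA] := pselect (exists n, A n None).
  by left; exists n => //; rewrite tauE; case: asboolP.
right=> m.
have GA n : [set` G n] `<=` trace (\bigcup_i two_strategy (mkseq A i.+1)).
  elim: n => [x //|n IH x]; rewrite GS /= mem_cat => /orP[/IH //|xl].
  exists n => //; rewrite tauE; case: asboolP => [/nA //|_]; by exists x.
apply: has_antichain_sub (GA m) _.
(* Each inning lengthens the largest antichain by at least one, so [G m] has one of [m] points. *)
elim: m => [|m IH]; first by exists [::].
by have [_ _] := raisingP m (nA m); apply.
Qed.

End Game.

Theorem mainTheorem2 : forall k : nat, (1 <= k)%N ->
  exists (X : topologicalType) (p : X),
    [/\ countable [set: X],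
        accessible_space X,
        ~` isolated [set: X] = [set p],
        one_has_winning_strategy k p &
        two_has_winning_strategy k.+1 p].
Proof.
move=> k _; exists (space k), None; split.
- exact: countableP.
- exact: space_accessible.
- exact: space_isolated.
- exact: one_wins.
- exact: two_wins.
Qed.
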